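(* (Soundness) For any formulas $\varphi,\psi\in\mathbb F$: if the sequent $\varphi\vdash\psi$ is derivable in the Turing Schmerl Calculus, then $\varphi\models\psi$, i.e. every $x\in I$ with $x\Vdash\varphi$ satisfies $x\Vdash\psi$ in the model $\mathcal J$.
   Context: **Ordinals.** $\Lambda$ is a fixed recursive ordinal that is an $\varepsilon$-number ($\Lambda>0$, $\omega^\Lambda=\Lambda$). $e^0$ is the identity on ordinals, $e=e^1$ is $\alpha\mapsto -1+\omega^\alpha$ (so $e(0)=0$ and $e(\alpha)=\omega^\alpha$ for $\alpha>0$), and $e^{n+m}=e^n\circ e^m$. The ordinal logarithm is $\ell(0):=0$, $\ell(\alpha+\omega^\beta):=\beta$. **Formulas.** $\mathbb F$ is the smallest set containing $\top$, closed under $\wedge$, and such that $\langle n^\alpha\rangle\varphi\in\mathbb F$ whenever $\varphi\in\mathbb F$, $n<\omega$, $\alpha<\Lambda$. By convention $\langle n^0\rangle\varphi$ is just $\varphi$. **Monomial normal forms.** The set $\mathsf{MNF}$ is defined inductively: (i) $\top\in\mathsf{MNF}$; (ii) $\langle n^\alpha\rangle\top\in\mathsf{MNF}$ for $n<\omega$ and $0<\alpha<\Lambda$; (iii) if $\langle n_0^{\alpha_0}\rangle\top\wedge\dots\wedge\langle n_k^{\alpha_k}\rangle\top\in\mathsf{MNF}$, $n<n_0$, and $\alpha<\Lambda$ is of the form $e^{n_0-n}(\alpha_0)\cdot(2+\delta)$ for some $\delta<\Lambda$, then $\langle n^\alpha\rangle\top\wedge\langle n_0^{\alpha_0}\rangle\top\wedge\dots\wedge\langle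 n_k^{\alpha_k}\rangle\top\in\mathsf{MNF}$. (Conjunctions are associated to the right.) **Turing Schmerl Calculus.** It derives sequents $\varphi\vdash\psi$ with $\varphi,\psi\in\mathbb F$; $\varphi\equiv\psi$ means both $\varphi\vdash\psi$ and $\psi\vdash\varphi$. Axioms (for all formulas, all $n,m<\omega$ and ordinals below $\Lambda$): 1. $\varphi\vdash\varphi$ and $\varphi\vdash\top$; 2. $\varphi\wedge\psi\vdash\varphi$ and $\varphi\wedge\psi\vdash\psi$; 3. Monotonicity: $\langle n^\alpha\rangle\varphi\vdash\langle n^\beta\rangle\varphi$ for $\beta<\alpha$; 4. Co-additivity: $\langle n^{\beta+\alpha}\rangle\varphi\equiv\langle n^\alpha\rangle\langle n^\beta\rangle\varphi$; 5. Reduction: $\langle (n+m)^\alpha\rangle\varphi\vdash\langle n^{e^m(\alpha)}\rangle\varphi$; 6. Schmerl: $\langle n^\alpha\rangle(\langle n_0^{\alpha_0}\rangle\top\wedge\psi)\equiv\langle n^{e^{n_0-n}(\alpha_0)\cdot(1+\alpha)}\rangle\top\wedge\langle n_0^{\alpha_0}\rangle\top\wedge\psi$ for $n<n_0$ and $\langle n_0^{\alpha_0}\rangle\top\wedge\psi\in\mathsf{MNF}$ (the conjunct $\psi$ may be absent). Rules: (R1) from $\varphi\vdash\psi$ and $\varphi\vdash\chi$ infer $\varphi\vdash\psi\wedge\chi$; (R2) from $\varphi\vdash\psi$ and $\psi\vdash\chi$ infer $\varphi\vdash\chi$; (R3) from $\varphi\vdash\psi$ infer $\langle n^\alpha\rangle\varphi\vdash\langle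 n^\alpha\rangle\psi$; (R4) from $\varphi\vdash\psi$ infer $\langle n^\alpha\rangle\varphi\wedge\langle m^{\beta+1}\rangle\psi\vdash\langle n^\alpha\rangle(\varphi\wedge\langle m^{\beta+1}\rangle\psi)$ for $n>m$. **The model $\mathcal J$.** $I$ is the set of sequences $x=\langle x_0,x_1,x_2,\dots\rangle$ of ordinals with $x_i<\Lambda$ and $x_{i+1}\le\ell(x_i)$ for all $i<\omega$. For $x,y\in I$: $xR_ny$ iff $x_m>y_m$ for all $m\le n$ and $x_i\ge y_i$ for all $i>n$. For $n<\omega$ and ordinals below $\Lambda$: $xR_n^0y$ iff $x=y$; $xR_n^{1+\alpha}y$ iff for all $\beta<1+\alpha$ there is $z\in I$ with $xR_nz$ and $zR_n^\beta y$. Truth: $x\Vdash\top$ always; $x\Vdash\varphi\wedge\psi$ iff $x\Vdash\varphi$ and $x\Vdash\psi$; $x\Vdash\langle n^\alpha\rangle\varphi$ iff there is $y\in I$ with $xR_n^\alpha y$ and $y\Vdash\varphi$. $\varphi\models\psi$ means: for all $x\in I$, $x\Vdash\varphi$ implies $x\Vdash\psi$. *)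

(* Defs.v *)
From HB Require Import structures.
From mathcomp Require Import all_boot all_order.
From mathcomp Require Import mathcomp_extra boolp classical_sets.

Set Implicit Arguments.
Unset Strict Implicit.
Unset Printing Implicit Defensive.

Import Order.TTheory.

Local Open Scope quotient_scope.
Local Open Scope classical_set_scope.
Local Open Scope order_scope.

(* [Node f] denotes the least ordinal strictly above all the [f a].  The
   ordinals are the trees modulo equality of the denoted ordinals, so that
   equality of ordinals is Leibniz equality. *)
Inductive tree : Type := Node (A : Set) (f : A -> tree).

Fixpoint tle (s t : tree) : Prop :=
  let: Node A f := s in let: Node B g := t in
  forall a : A, exists b : B, tle (f a) (g b).

Lemma tle_refl s : tle s s.
Proof. by elim: s => A f IH /= a; exists a. Qed.

Lemma tle_trans s t u : tle s t -> tle t u -> tle s u.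
Proof.
elim: s t u => A f IH [B g] [C h] /= st tu a.
by have [b ab] := st a; have [c bc] := tu b; exists c; apply: IH bc.
Qed.

Lemma tle_child (A : Set) (f : A -> tree) a : tle (f a) (Node f).
Proof.
suff H s : forall (A : Set) (f : A -> tree) a, tle s (f a) -> tle s (Node f).
  by apply: H (tle_refl _).
elim: s => B g IH {}A {}f {}a gf b; exists a.
case: (f a) gf => C h gh.
by have [c bc] := gh b; apply: IH bc.
Qed.

Lemma tle_total s t : tle s t \/ tle t s.
Proof.
have H : tle s t \/ let: Node A f := s in exists a, tle t (f a).
  elim: s t => A f IH [B g]; have [|/existsNP[a nab]] := pselect (tle (Node f) (Node g)).
    by left.
  right; exists a; move: (IH a) nab; case: (f a) => C h IHa nab b.
  have [gb|//] := IHa (g b).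
  by case: nab; exists b.
case: H; first by left.
by case: s => A f [a ta]; right; apply: tle_trans ta (tle_child f a).
Qed.

HB.instance Definition _ := gen_eqMixin tree.
HB.instance Definition _ := gen_choiceMixin tree.

Definition teq (s t : tree) : bool := `[< tle s t >] && `[< tle t s >].

Lemma teq_refl : reflexive teq.
Proof. by move=> s; apply/andP; split; apply/asboolP; apply: tle_refl. Qed.

Lemma teq_sym : symmetric teq.
Proof. by move=> s t; rewrite /teq andbC. Qed.

Lemma teq_trans : transitive teq.
Proof.
move=> t s u /andP[/asboolP st /asboolP ts] /andP[/asboolP tu /asboolP ut].
by apply/andP; split; apply/asboolP; [apply: tle_trans tu|apply: tle_trans ts].
Qed.

Canonical teq_equiv := EquivRel teq teq_refl teq_sym teq_trans.

Definition ord : Type := {eq_quot teq}.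
HB.instance Definition _ := Choice.on ord.
HB.instance Definition _ := EqQuotient.on ord.

Definition ole (x y : ord) : bool := `[< tle (repr x) (repr y) >].

Lemma ole_refl : reflexive ole.
Proof. by move=> x; apply/asboolP; apply: tle_refl. Qed.

Lemma ole_anti : antisymmetric ole.
Proof.
move=> x y /andP[xy yx]; rewrite -[x]reprK -[y]reprK.
by apply/eqmodP; apply/andP.
Qed.

Lemma ole_trans : transitive ole.
Proof.
move=> y x z /asboolP xy /asboolP yz; apply/asboolP; exact: tle_trans yz.
Qed.

Lemma ole_total : total ole.
Proof.
move=> x y; apply/orP.
by case: (tle_total (repr x) (repr y)) => ?; [left|right]; apply/asboolP.
Qed.

Fact ord_display : Order.disp_t. Proof. exact: Order.Disp tt tt. Qed.
HB.instance Definition _ :=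
  Order.Le_isPOrder.Build ord_display ord ole_refl ole_anti ole_trans.
HB.instance Definition _ := Order.POrder_isTotal.Build ord_display ord ole_total.

Lemma pi_tle s t : (\pi_ord s <= \pi_ord t) = `[< tle s t >].
Proof.
rewrite /Order.le /= /ole; apply/asbool_equiv_eq.
have pi_repr u : tle (repr (\pi_ord u)) u /\ tle u (repr (\pi_ord u)).
  have /eqmodP/andP[/asboolP ? /asboolP ?] : repr (\pi_ord u) = u %[mod {eq_quot teq}].
    exact: reprK.
  by [].
have [s1 s2] := pi_repr s; have [t1 t2] := pi_repr t; split=> st.
  by apply: tle_trans s2 (tle_trans st t1).
by apply: tle_trans s1 (tle_trans st t2).
Qed.

(* The ordinals below [a + b] are covered by those below [a] and
    the [a + b'] with [b' < b]; those below [a * b] by the [a * b' + a'] with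
    [a' < a] and [b' < b]; those below [omega^b] by [0] and the
    [omega^b' * n] with [b' < b] and [n] finite. *)

Fixpoint tadd (s t : tree) : tree :=
  let: Node A f := s in let: Node B g := t in
  Node (fun c : A + B => match c with inl a => f a | inr b => tadd s (g b) end).

Fixpoint tmul (s t : tree) : tree :=
  let: Node A f := s in let: Node B g := t in
  Node (fun c : B * A => tadd (tmul s (g c.1)) (f c.2)).

Definition tzero : tree := Node (fun c : Empty_set => match c with end).
Definition tsucc (s : tree) : tree := Node (fun _ : unit => s).
Definition tnat (n : nat) : tree := iter n tsucc tzero.

Fixpoint texp (t : tree) : tree :=
  let: Node B g := t in
  Node (fun c : option (B * nat) =>
          if c is Some (b, n) then tmul (texp (g b)) (tnat n) else tzero).

Lemma tadd_mono s s' t t' : tle s s' -> tle t t' -> tle (tadd s t) (tadd s' t').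
Proof.
case: s s' => A f [A' f'] ss'; elim: t t' => B g IH [B' g'] /= tt' [a|b].
  by have [a' ?] := ss' a; exists (inl a').
by have [b' ?] := tt' b; exists (inr b'); apply: IH.
Qed.

Lemma tmul_mono s s' t t' : tle s s' -> tle t t' -> tle (tmul s t) (tmul s' t').
Proof.
case: s s' => A f [A' f'] ss'; elim: t t' => B g IH [B' g'] /= tt' [b a] /=.
have [a' ?] := ss' a; have [b' ?] := tt' b.
by exists (b', a'); apply: tadd_mono => //=; apply: IH.
Qed.

Lemma texp_mono t t' : tle t t' -> tle (texp t) (texp t').
Proof.
elim: t t' => B g IH [B' g'] /= tt' [[b n]|]; last by exists None.
have [b' ?] := tt' b; exists (Some (b', n)).
by apply: tmul_mono (tle_refl _); apply: IH.
Qed.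

Definition onat (n : nat) : ord := \pi_ord (tnat n).
Definition oadd : ord -> ord -> ord := lift_op2 ord tadd.
Definition omul : ord -> ord -> ord := lift_op2 ord tmul.
Definition omega_exp : ord -> ord := lift_op1 ord texp.

Lemma pi_eq s t : tle s t -> tle t s -> \pi_ord s = \pi_ord t.
Proof. by move=> st ts; apply: le_anti; rewrite !pi_tle; apply/andP; split; apply/asboolP. Qed.

Lemma repr_pi s : tle (repr (\pi_ord s)) s /\ tle s (repr (\pi_ord s)).
Proof.
by split; apply/asboolP; rewrite -pi_tle reprK.
Qed.

Lemma pi_oadd : {morph \pi_ord : s t / tadd s t >-> oadd s t}.
Proof.
move=> s t; have [s1 s2] := repr_pi s; have [t1 t2] := repr_pi t.
by unlock oadd; apply: pi_eq; apply: tadd_mono.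
Qed.

Lemma pi_omul : {morph \pi_ord : s t / tmul s t >-> omul s t}.
Proof.
move=> s t; have [s1 s2] := repr_pi s; have [t1 t2] := repr_pi t.
by unlock omul; apply: pi_eq; apply: tmul_mono.
Qed.

Lemma pi_omega_exp : {morph \pi_ord : t / texp t >-> omega_exp t}.
Proof.
move=> t; have [t1 t2] := repr_pi t.
by unlock omega_exp; apply: pi_eq; apply: texp_mono.
Qed.

Canonical pi_oadd_morph := PiMorph2 pi_oadd.
Canonical pi_omul_morph := PiMorph2 pi_omul.
Canonical pi_omega_exp_morph := PiMorph1 pi_omega_exp.

Declare Scope ord_scope.
Delimit Scope ord_scope with ord.
Bind Scope ord_scope with ord.
Notation "0" := (onat 0) : ord_scope.
Notation "1" := (onat 1) : ord_scope.
Notation "2" := (onat 2) : ord_scope.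
Notation "x + y" := (oadd x y) : ord_scope.
Notation "x * y" := (omul x y) : ord_scope.
Local Open Scope ord_scope.

Definition epsilon_number (L : ord) : Prop := 0 < L /\ omega_exp L = L.

(* [left_sub a b] is [-a + b]: the [c] with [a + c = b] ([0] if there is none). *)
Definition left_sub (a b : ord) : ord := xget 0 [set c | a + c = b].

Definition e (a : ord) : ord := left_sub 1 (omega_exp a).

Definition hyperexp (n : nat) (a : ord) : ord := iter n e a.

(* [0] is not of the form [a + omega^b], so that [olog 0 = 0]. *)
Definition olog (x : ord) : ord :=
  xget 0 [set b | exists a, x = a + omega_exp b].

(* The total mu-recursive functions, with minimization of regular functions. *)
Inductive mu_recursive : forall k, (k.-tuple nat -> nat) -> Prop :=
| mu_zero : mu_recursive (fun _ : 0.-tuple nat => 0%N)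
| mu_succ : mu_recursive (fun v : 1.-tuple nat => (thead v).+1)
| mu_proj k (i : 'I_k) : mu_recursive (fun v : k.-tuple nat => tnth v i)
| mu_comp k m (f : m.-tuple nat -> nat) (g : 'I_m -> k.-tuple nat -> nat) :
    mu_recursive f -> (forall i, mu_recursive (g i)) ->
    mu_recursive (fun v => f [tuple g i v | i < m])
| mu_rec k (f : k.-tuple nat -> nat) (g : k.+2.-tuple nat -> nat)
    (h : k.+1.-tuple nat -> nat) :
    mu_recursive f -> mu_recursive g ->
    (forall v : k.-tuple nat, h [tuple of 0%N :: v] = f v) ->
    (forall n (v : k.-tuple nat), h [tuple of n.+1 :: v] =
       g [tuple of n :: h [tuple of n :: v] :: v]) ->
    mu_recursive h
| mu_min k (f : k.+1.-tuple nat -> nat) (g : k.-tuple nat -> nat) :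
    mu_recursive f ->
    (forall v : k.-tuple nat, f [tuple of g v :: v] = 0%N) ->
    (forall (v : k.-tuple nat) n, (n < g v)%N -> f [tuple of n :: v] <> 0%N) ->
    mu_recursive g.

(* [L] is the order type of a recursive relation [r] on a recursive set [D] of
   natural numbers; [f] is the order isomorphism. *)
Definition recursive_ordinal (L : ord) : Prop :=
  exists (D : pred nat) (r : rel nat) (f : nat -> ord),
    [/\ mu_recursive (fun v : 1.-tuple nat => nat_of_bool (D (thead v))),
        mu_recursive (fun v : 2.-tuple nat =>
                        nat_of_bool (r (tnth v ord0) (tnth v ord_max))),
        {in D &, injective f},
        {in D &, forall i j, r i j = (f i < f j)} &
        forall a, a < L <-> exists2 i, D i & f i = a].

Definition below (L : ord) : Type := {a : ord | a < L}.
Definition below_val (L : ord) (a : below L) : ord := sval a.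
Coercion below_val : below >-> ord.

Definition pbelow (L : ord) : Type := {a : ord | 0 < a < L}.
Definition pbelow_val (L : ord) (a : pbelow L) : ord := sval a.
Coercion pbelow_val : pbelow >-> ord.

(* The constructor [Dia] only takes exponents [0 < a < L]; [dia] takes all the
   exponents [a < L] and identifies [<n^0> phi] with [phi]. *)
Inductive form (L : ord) : Type :=
| Top
| And of form L & form L
| Dia of nat & pbelow L & form L.
Arguments Top {L}.

Definition dia (L : ord) (n : nat) (a : below L) (phi : form L) : form L :=
  if insub (a : ord) is Some b then @Dia L n b phi else phi.

(* [headed n a phi] iff [phi] is [<n^a> Top] or [<n^a> Top /\ psi]. *)
Definition headed (L : ord) (n : nat) (a : pbelow L) (phi : form L) : Prop :=
  phi = Dia n a Top \/ exists psi, phi = And (Dia n a Top) psi.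

Inductive MNF (L : ord) : form L -> Prop :=
| MNF_top : MNF Top
| MNF_mono n (a : pbelow L) : MNF (Dia n a Top)
| MNF_cons n (a : pbelow L) n0 (a0 : pbelow L) (d : below L) phi :
    MNF phi -> headed n0 a0 phi -> (n < n0)%N ->
    a = hyperexp (n0 - n) a0 * (2 + d) :> ord ->
    MNF (And (Dia n a Top) phi).

(* Where an axiom mentions a compound exponent, that exponent is named ([c])
   and constrained by an equation between ordinals. *)
Inductive derives (L : ord) : form L -> form L -> Prop :=
| TSC_refl phi : derives phi phi
| TSC_top phi : derives phi Top
| TSC_andl phi psi : derives (And phi psi) phi
| TSC_andr phi psi : derives (And phi psi) psi
| TSC_mono n (a b : below L) phi :
    (b : ord) < (a : ord) -> derives (dia n a phi) (dia n b phi)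
| TSC_coadd_l n (a b c : below L) phi :
    c = b + a :> ord -> derives (dia n c phi) (dia n a (dia n b phi))
| TSC_coadd_r n (a b c : below L) phi :
    c = b + a :> ord -> derives (dia n a (dia n b phi)) (dia n c phi)
| TSC_red n m (a c : below L) phi :
    c = hyperexp m a :> ord -> derives (dia (n + m)%N a phi) (dia n c phi)
| TSC_schmerl_l n (a c : below L) n0 (a0 : pbelow L) phi :
    MNF phi -> headed n0 a0 phi -> (n < n0)%N ->
    c = hyperexp (n0 - n) a0 * (1 + a) :> ord ->
    derives (dia n a phi) (And (dia n c Top) phi)
| TSC_schmerl_r n (a c : below L) n0 (a0 : pbelow L) phi :
    MNF phi -> headed n0 a0 phi -> (n < n0)%N ->
    c = hyperexp (n0 - n) a0 * (1 + a) :> ord ->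
    derives (And (dia n c Top) phi) (dia n a phi)
| TSC_and phi psi chi :
    derives phi psi -> derives phi chi -> derives phi (And psi chi)
| TSC_cut phi psi chi :
    derives phi psi -> derives psi chi -> derives phi chi
| TSC_nec n (a : below L) phi psi :
    derives phi psi -> derives (dia n a phi) (dia n a psi)
| TSC_R4 n m (a b c : below L) phi psi :
    derives phi psi -> (m < n)%N -> c = b + 1 :> ord ->
    derives (And (dia n a phi) (dia m c psi)) (dia n a (And phi (dia m c psi))).

Definition seqI (L : ord) : set (nat -> ord) :=
  [set x | forall i, x i < L /\ x i.+1 <= olog (x i)].

Definition Rstep (n : nat) (x y : nat -> ord) : Prop :=
  (forall m, (m <= n)%N -> y m < x m) /\ (forall i, (n < i)%N -> y i <= x i).

(* Read as an equation by recursion on the exponent: exactly one of the two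
   clauses applies to a given exponent. *)
Inductive Rpow (L : ord) (n : nat) : ord -> (nat -> ord) -> (nat -> ord) -> Prop :=
| Rpow0 x : Rpow L n 0 x x
| RpowS a x y :
    (forall b, b < 1 + a -> exists z, [/\ seqI L z, Rstep n x z & Rpow L n b z y]) ->
    Rpow L n (1 + a) x y.

Fixpoint forces (L : ord) (x : nat -> ord) (phi : form L) : Prop :=
  match phi with
  | Top => True
  | And psi chi => forces x psi /\ forces x chi
  | Dia n a psi => exists y, [/\ seqI L y, Rpow L n a x y & forces y psi]
  end.

Definition models (L : ord) (phi psi : form L) : Prop :=
  forall x, seqI L x -> forces x phi -> forces x psi.

(* Main.v *)
Require Import Defs.
From mathcomp Require Import all_boot all_order.
From mathcomp Require Import boolp classical_sets.

(** Everything rests on a closed form of the iterated relations: for [a > 0]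
    and [x], [y] in the model, [x R_n^a y] holds iff [y i < x i] for [i < n],
    [y n + omega^(y n.+1) * a <= x n], and [y i <= x i] for [i > n] (the
    predicate [jump], lemma [Rpow_jump]). The reason is that [x n] and [y n]
    are multiples of [omega^(y n.+1)], so each step along [R_n] costs at least
    one summand [omega^(y n.+1)] at position [n]; and conversely an
    intermediate value at [n] can always be completed below [n] by adding powers
    of omega ([raise_below]).

    From this, truth is preserved when a sequence increases pointwise
    ([forces_persistent]), which gives monotonicity; co-additivity is
    distributivity of multiplication over addition on the right, and reduction
    holds because [x n] is a multiple of [omega^(x n.+1)] ([jump_reduce]).

    For the rule R4 one uses that a satisfiable formula only bounds each term
    from below ([forces_bounds]), and hence has a pointwise least model
    ([least_model]): the witness of the second conjunct may be taken to be this
    least model, which lies below every other point under consideration. For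
    the Schmerl axiom the least model of a monomial normal form is computed
    explicitly, as a tower of exponentials below its head
    ([MNF_least_model]); the axiom then reads
    [omega^g + omega^g * a = omega^g * (1 + a)].

    The ordinal arithmetic is derived from descriptions of the ordinals below
    [x + y], [x * y] and [omega^b], by well-founded induction. *)

Set Implicit Arguments.
Unset Strict Implicit.
Unset Printing Implicit Defensive.

Import Order.TTheory.

Local Open Scope quotient_scope.
Local Open Scope order_scope.
Local Open Scope ord_scope.

(** * Ordinal arithmetic *)

(** [\pi_ord (Node f)] is the least strict upper bound of the [f a]. *)
Lemma lt_pi_node x (A : Set) (f : A -> tree) :
  x < \pi_ord (Node f) <-> exists a, x <= \pi_ord (f a).
Proof.
have no_cycle s : forall (B : Set) (g : B -> tree) b, tle s (g b) -> ~ tle (Node g) s.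
  elim: s => C h IH B g b sg gs.
  have [c gc] := gs b.
  exact: IH (tle_refl _) (tle_trans sg gc).
split=> [|[a xa]]; last first.
  apply: le_lt_trans xa _; rewrite ltNge pi_tle; apply/asboolP.
  exact: no_cycle (tle_refl _).
have dichotomy t : forall s,
    tle t s \/ let: Node B g := t in exists b, tle s (g b).
  elim: t => B g IH [C h].
  have [|/existsNP[b nb]] := pselect (tle (Node g) (Node h)); first by left.
  right; exists b; move: (IH b) nb; case: (g b) => D k IHb nb c.
  by have [kc|//] := IHb (h c); case: nb; exists c.
elim/quotW: x => s; rewrite ltNge pi_tle => /asboolP nfs.
have [//|[a sa]] := dichotomy (Node f) s.
by exists a; rewrite pi_tle; apply/asboolP.
Qed.

Lemma ord_ind (P : ord -> Prop) :
  (forall x, (forall y, y < x -> P y) -> P x) -> forall x, P x.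
Proof.
move=> H x; elim/quotW: x => t.
suff: forall x, x <= \pi_ord t -> P x by apply; exact: lexx.
elim: t => A f IH x xf; apply: H => y yx.
have [a ya] := (lt_pi_node _ _).1 (lt_le_trans yx xf).
exact: IH ya.
Qed.

Lemma least_ord (P : ord -> Prop) :
  (exists x, P x) -> exists2 x, P x & forall y, P y -> x <= y.
Proof.
move=> [x]; elim/ord_ind: x => x IH Px.
have [[y [yx Py]]|H] := pselect (exists y, y < x /\ P y); first exact: IH Py.
exists x => // y Py; rewrite leNgt; apply/negP => yx; apply: H; by exists y.
Qed.

Lemma le_from_lt (x y : ord) : (forall z, z < x -> z < y) -> x <= y.
Proof. by move=> H; rewrite leNgt; apply/negP => /H; rewrite ltxx. Qed.

Lemma le0o x : 0 <= x.
Proof. by apply: le_from_lt => z /lt_pi_node[[]]. Qed.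

Lemma lt0o_neq x : (0 < x) = (x != 0).
Proof. by rewrite lt_neqAle le0o andbT eq_sym. Qed.

Lemma ord_eq0_or_gt0 x : x = 0 \/ 0 < x.
Proof. by rewrite lt0o_neq; case: eqVneq; [left|right]. Qed.

Lemma leo0_eq x : x <= 0 -> x = 0.
Proof. by move=> x0; apply: le_anti; rewrite x0 le0o. Qed.

Lemma lt_onatS z n : z < onat n.+1 <-> z <= onat n.
Proof. by split=> [/lt_pi_node[]|h] //; apply/lt_pi_node; exists tt. Qed.

Lemma lto1 z : z < 1 <-> z = 0.
Proof.
split=> [/lt_onatS/leo0_eq //|->]; exact/lt_onatS.
Qed.

Lemma lt01o : 0 < 1. Proof. exact/lto1. Qed.

Lemma le1o z : (1 <= z) = (0 < z).
Proof.
apply/idP/idP => [|z0]; first exact: lt_le_trans lt01o.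
by rewrite leNgt; apply/negP => /lto1 E; rewrite E ltxx in z0.
Qed.

Lemma leo_add x x' y y' : x <= x' -> y <= y' -> x + y <= x' + y'.
Proof.
elim/quotW: x => x; elim/quotW: x' => x'; elim/quotW: y => y; elim/quotW: y' => y'.
rewrite !pi_tle => /asboolP xx /asboolP yy; rewrite -!pi_oadd pi_tle; apply/asboolP.
exact: tadd_mono.
Qed.

Lemma leo_mul x x' y y' : x <= x' -> y <= y' -> x * y <= x' * y'.
Proof.
elim/quotW: x => x; elim/quotW: x' => x'; elim/quotW: y => y; elim/quotW: y' => y'.
rewrite !pi_tle => /asboolP xx /asboolP yy; rewrite -!pi_omul pi_tle; apply/asboolP.
exact: tmul_mono.
Qed.

Lemma leo_exp x x' : x <= x' -> omega_exp x <= omega_exp x'.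
Proof.
elim/quotW: x => x; elim/quotW: x' => x'.
rewrite !pi_tle => /asboolP xx; rewrite -!pi_omega_exp pi_tle; apply/asboolP.
exact: texp_mono.
Qed.

Lemma lt_oadd z x y :
  z < x + y <-> z < x \/ exists2 y', y' < y & z <= x + y'.
Proof.
elim/quotW: x => x; elim/quotW: y => y.
split.
  rewrite -pi_oadd; case: x y => [A f] [B g] /lt_pi_node[[a|b] h].
    by left; apply/lt_pi_node; exists a.
  right; exists (\pi_ord (g b)); first by apply/lt_pi_node; exists b.
  by rewrite -pi_oadd.
rewrite -pi_oadd; case: x y => [A f] [B g] [|[y']] /lt_pi_node[c h].
  by apply/lt_pi_node; exists (inl c).
move=> zy; apply/lt_pi_node; exists (inr c).
by rewrite pi_oadd; apply: le_trans zy _; apply: leo_add.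
Qed.

Lemma lt_omul z x y :
  z < x * y <-> exists y' x', [/\ y' < y, x' < x & z <= x * y' + x'].
Proof.
elim/quotW: x => x; elim/quotW: y => y.
split.
  rewrite -pi_omul; case: x y => [A f] [B g] /lt_pi_node[[b a] h].
  exists (\pi_ord (g b)), (\pi_ord (f a)); split.
  - by apply/lt_pi_node; exists b.
  - by apply/lt_pi_node; exists a.
  - by rewrite -pi_omul -pi_oadd.
rewrite -pi_omul; case: x y => [A f] [B g] [y' [x' []]].
move=> /lt_pi_node[b yb] /lt_pi_node[a xa] h.
apply/lt_pi_node; exists (b, a); apply: le_trans h _.
by rewrite pi_oadd pi_omul; apply: leo_add => //; apply: leo_mul.
Qed.

Lemma lt_omega_exp z b :
  z < omega_exp b <->
    z = 0 \/ exists2 b', b' < b & exists n, z <= omega_exp b' * onat n.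
Proof.
elim/quotW: b => b.
split.
  rewrite -pi_omega_exp; case: b => [B g] /lt_pi_node[[[b n]|] h].
    right; exists (\pi_ord (g b)); first by apply/lt_pi_node; exists b.
    by exists n; rewrite -pi_omega_exp -pi_omul.
  by left; apply: leo0_eq.
rewrite -pi_omega_exp; case: b => [B g] [->|[b' /lt_pi_node[b bb] [n h]]].
  apply/lt_pi_node; exists None; exact: lexx.
apply/lt_pi_node; exists (Some (b, n)); apply: le_trans h _.
by rewrite pi_omul pi_omega_exp; apply: leo_mul => //; apply: leo_exp.
Qed.

Lemma addo0 x : x + 0 = x.
Proof.
apply: le_anti; apply/andP; split; apply: le_from_lt => z.
  by move=> /lt_oadd[//|[y]]; rewrite ltNge le0o.
by move=> zx; apply/lt_oadd; left.
Qed.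

Lemma ltoD2l x y y' : y < y' -> x + y < x + y'.
Proof. by move=> yy; apply/lt_oadd; right; exists y. Qed.

Lemma leoD2l x y y' : (x + y <= x + y') = (y <= y').
Proof.
apply/idP/idP => [|h]; last exact: leo_add.
by apply: contraTT; rewrite -!ltNge; apply: ltoD2l.
Qed.

Lemma addoI x : injective (oadd x).
Proof. by move=> y y' h; apply: le_anti; rewrite -(leoD2l x) -(leoD2l x y') h lexx. Qed.

Lemma leo_addr x y : x <= x + y.
Proof. by rewrite -{1}[x]addo0 leoD2l le0o. Qed.

Lemma add0o x : 0 + x = x.
Proof.
elim/ord_ind: x => x IH.
apply: le_anti; apply/andP; split; apply: le_from_lt => z.
  move=> /lt_oadd[|[y yx]]; first by rewrite ltNge le0o.
  by rewrite IH // => /le_lt_trans; apply.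
by move=> zx; apply/lt_oadd; right; exists z => //; rewrite IH.
Qed.

Lemma leo_addl x y : y <= x + y.
Proof. by rewrite -{1}[y]add0o; apply: leo_add => //; apply: le0o. Qed.

Lemma addoA x y z : x + (y + z) = x + y + z.
Proof.
elim/ord_ind: z => z IH.
apply: le_anti; apply/andP; split; apply: le_from_lt => w /lt_oadd[].
- move=> wx; apply: lt_le_trans wx _.
  exact: le_trans (leo_addr x y) (leo_addr _ z).
- move=> [u /lt_oadd[uy|[z' zz uz]] wu]; apply: le_lt_trans wu _.
    by apply: lt_le_trans (ltoD2l _ uy) _; apply: leo_addr.
  by apply: le_lt_trans (ltoD2l _ zz); rewrite -IH // leoD2l.
- by move=> wxy; apply: lt_le_trans wxy _; rewrite leoD2l leo_addr.
- move=> [z' zz wz]; apply: le_lt_trans wz _; rewrite -IH //.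
  by apply: ltoD2l; apply: ltoD2l.
Qed.

Lemma lto_add1 x z : z < x + 1 <-> z <= x.
Proof.
split=> [/lt_oadd[/ltW //|[y /lto1 ->]]|zx]; first by rewrite addo0.
by apply: le_lt_trans zx _; rewrite -[ltLHS]addo0; apply/ltoD2l/lt01o.
Qed.

Lemma leo_add1 x z : (z + 1 <= x) = (z < x).
Proof.
apply/idP/idP => [|zx]; first by apply: lt_le_trans; apply/lto_add1.
by rewrite leNgt; apply/negP => /lto_add1; rewrite leNgt zx.
Qed.

Lemma onatS n : onat n.+1 = onat n + 1.
Proof.
by apply: le_anti; apply/andP; split; apply: le_from_lt => z;
  [move/lt_onatS/lto_add1|move/lto_add1/lt_onatS].
Qed.

Lemma onatD m n : onat (m + n)%N = onat m + onat n.
Proof.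
elim: n => [|n IH]; first by rewrite addn0 addo0.
by rewrite addnS (onatS n) (onatS (m + n)) IH addoA.
Qed.

Lemma exists_oadd x y : x <= y -> exists z, y = x + z.
Proof.
move=> xy; have [|z yz zmin] := @least_ord (fun z => y <= x + z).
  exists y; exact: leo_addl.
exists z; apply: le_anti; rewrite yz /= leNgt; apply/negP => /lt_oadd[|[z' zz yz']].
  by rewrite ltNge xy.
by have := zmin _ yz'; rewrite leNgt zz.
Qed.

Lemma mulo0 x : x * 0 = 0.
Proof. by apply: leo0_eq; apply: le_from_lt => z /lt_omul[y [u []]]; rewrite ltNge le0o. Qed.

Lemma mulo1 x : x * 1 = x.
Proof.
apply: le_anti; apply/andP; split; apply: le_from_lt => z.
  by move=> /lt_omul[y [u [/lto1-> ux]]]; rewrite mulo0 add0o => /le_lt_trans; apply.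
by move=> zx; apply/lt_omul; exists 0, z; rewrite mulo0 add0o lt01o.
Qed.

Lemma muloDr x y z : x * (y + z) = x * y + x * z.
Proof.
elim/ord_ind: z => z IH.
apply: le_anti; apply/andP; split; apply: le_from_lt => w.
  move=> /lt_omul[u [x' [/lt_oadd[uy|[z' zz uz]] xx wu]]].
    by apply/lt_oadd; left; apply/lt_omul; exists u, x'.
  apply: le_lt_trans wu _.
  have : x * z' + x' < x * z by apply/lt_omul; exists z', x'.
  move/(ltoD2l (x * y)); apply: le_lt_trans.
  by rewrite addoA -IH //; apply: leo_add => //; apply: leo_mul.
move=> /lt_oadd[/lt_omul[u [x' [uy xx wu]]]|[v /lt_omul[z' [x' [zz xx vz]]] wv]].
  apply/lt_omul; exists u, x'; split=> //; exact: lt_le_trans uy (leo_addr _ _).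
apply/lt_omul; exists (y + z'), x'; split=> //; first exact: ltoD2l.
by apply: le_trans wv _; rewrite IH // -addoA leoD2l.
Qed.

Lemma muloA x y z : x * (y * z) = x * y * z.
Proof.
elim/ord_ind: z => z IH.
apply: le_anti; apply/andP; split; apply: le_from_lt => w.
  move=> /lt_omul[u [x' [/lt_omul[z' [y' [zz yy uz]]] xx wu]]].
  apply/lt_omul; exists z', (x * y' + x'); split=> //.
    by apply/lt_omul; exists y', x'.
  apply: le_trans wu _; rewrite addoA -IH // -muloDr.
  by apply: leo_add => //; apply: leo_mul.
move=> /lt_omul[z' [v [zz /lt_omul[y' [x' [yy xx vy]]] wz]]].
apply/lt_omul; exists (y * z' + y'), x'; split=> //.
  by apply/lt_omul; exists z', y'.
by apply: le_trans wz _; rewrite muloDr IH // -addoA leoD2l.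
Qed.

Lemma ltoM2l x y y' : 0 < x -> y < y' -> x * y < x * y'.
Proof.
move=> x0 yy; apply/lt_omul; exists y, 0; split=> //.
by rewrite addo0.
Qed.

Lemma leo_mull x y : 0 < x -> y <= x * y.
Proof.
move=> x0; elim/ord_ind: y => y IH; apply: le_from_lt => z zy.
by apply: le_lt_trans (IH _ zy) _; apply: ltoM2l.
Qed.

Lemma leo_mulr x y : 0 < y -> x <= x * y.
Proof. by move=> y0; rewrite -{1}[x]mulo1; apply: leo_mul; rewrite // le1o. Qed.

Lemma mul1o x : 1 * x = x.
Proof.
apply: le_anti; rewrite leo_mull ?lt01o // andbT.
elim/ord_ind: x => x IH; apply: le_from_lt => z /lt_omul[y [u [yx /lto1->]]].
by rewrite addo0 => /le_trans/(_ (IH _ yx))/le_lt_trans; apply.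
Qed.

Lemma mulo_gt0 x y : 0 < x -> 0 < y -> 0 < x * y.
Proof. by move=> x0 y0; apply: lt_le_trans y0 (leo_mull _ x0). Qed.

Lemma odivision x y : 0 < x -> exists q r, y = x * q + r /\ r < x.
Proof.
move=> x0; have [|q [r rx yq] qmin] :=
    @least_ord (fun q => exists2 r, r < x & y <= x * q + r).
  by exists y, 0 => //; rewrite addo0 leo_mull.
have : x * q <= y.
  rewrite leNgt; apply/negP => /lt_omul[q' [r' [qq rx' yq']]].
  have : q <= q' by apply: qmin; exists r'.
  by rewrite leNgt qq.
move=> /exists_oadd[s ys]; exists q, s; split=> //.
by apply: le_lt_trans rx; rewrite ys leoD2l in yq.
Qed.

(** * Powers of omega *)

Lemma omega_exp0 : omega_exp 0 = 1.
Proof.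
apply: le_anti; apply/andP; split; apply: le_from_lt => z.
  by move=> /lt_omega_exp[->|[b]]; [exact: lt01o|rewrite ltNge le0o].
by move=> /lto1 ->; apply/lt_omega_exp; left.
Qed.

Lemma omega_exp_gt0 b : 0 < omega_exp b.
Proof. by apply/lt_omega_exp; left. Qed.

Lemma lto_exp x y : x < y -> omega_exp x < omega_exp y.
Proof.
move=> xy; apply/lt_omega_exp; right; exists x => //; exists 1%N.
by rewrite mulo1.
Qed.

Lemma leo_expl b : b <= omega_exp b.
Proof.
elim/ord_ind: b => b IH; apply: le_from_lt => z zb.
by apply: le_lt_trans (IH _ zb) _; apply: lto_exp.
Qed.

Lemma omega_expD a b : omega_exp (a + b) = omega_exp a * omega_exp b.
Proof.
elim/ord_ind: b => b IH.
apply: le_anti; apply/andP; split; apply: le_from_lt => z.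
  move=> /lt_omega_exp[->|[u /lt_oadd[ua|[b' bb ub]] [n zu]]].
  - exact: mulo_gt0 (omega_exp_gt0 _) (omega_exp_gt0 _).
  - apply: lt_le_trans (leo_mulr _ (omega_exp_gt0 b)).
    by apply/lt_omega_exp; right; exists u => //; exists n.
  - apply: le_lt_trans zu _.
    apply: (@le_lt_trans _ _ (omega_exp a * (omega_exp b' * onat n))).
      by rewrite muloA -IH //; apply: leo_mul => //; apply: leo_exp.
    apply: ltoM2l; first exact: omega_exp_gt0.
    by apply/lt_omega_exp; right; exists b' => //; exists n.
move=> /lt_omul[y [r [/lt_omega_exp[->|[b' bb [n yb]]] ra zy]]].
  apply: le_lt_trans zy _; rewrite mulo0 add0o; apply: lt_le_trans ra _.
  exact/leo_exp/leo_addr.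
apply/lt_omega_exp; right; exists (a + b'); first exact: ltoD2l.
exists n.+1; apply: le_trans zy _.
rewrite IH // -muloA onatS muloDr muloDr; apply: leo_add.
  exact: leo_mul.
rewrite mulo1; apply: le_trans (ltW ra) _; apply: leo_mulr; exact: omega_exp_gt0.
Qed.

Lemma omega_exp_indecomposable d r s :
  r < omega_exp d -> s < omega_exp d -> r + s < omega_exp d.
Proof.
move=> rd sd; case/lt_omega_exp: (rd) => [->|[b bd [n rb]]]; first by rewrite add0o.
case/lt_omega_exp: (sd) => [->|[c cd [m sc]]]; first by rewrite addo0.
apply/lt_omega_exp; right; exists (Order.max b c); first by rewrite gt_max bd.
exists (n + m)%N; rewrite onatD muloDr; apply: leo_add.
  by apply: le_trans rb _; apply: leo_mul => //; apply: leo_exp; rewrite le_max lexx.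
by apply: le_trans sc _; apply: leo_mul => //; apply: leo_exp; rewrite le_max lexx orbT.
Qed.

Lemma omega_exp_absorb d r : r < omega_exp d -> r + omega_exp d = omega_exp d.
Proof.
move=> rd; apply: le_anti; rewrite leo_addl andbT.
apply: le_from_lt => z /lt_oadd[zr|[s sd zs]]; first exact: lt_trans rd.
exact: le_lt_trans zs (omega_exp_indecomposable rd sd).
Qed.

(** Between an ordinal and a larger multiple of [omega^d] there is room for
    one more summand [omega^d]. *)
Lemma multiple_gap d k y :
  y < omega_exp d * k -> y + omega_exp d <= omega_exp d * k.
Proof.
move=> /lt_omul[k' [r [kk rd yk]]].
apply: le_trans (_ : omega_exp d * (k' + 1) <= _); last first.
  by apply: leo_mul; rewrite // leo_add1.
rewrite muloDr mulo1 -{3}(omega_exp_absorb rd) addoA.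
exact: leo_add.
Qed.

Lemma multiple_gap_lt d k y u :
  y < omega_exp d * k -> u < omega_exp d -> y + u < omega_exp d * k.
Proof. by move=> yk ud; apply: lt_le_trans (multiple_gap yk); apply: ltoD2l. Qed.

(** * The ordinal logarithm *)

Lemma exists_last_term x : 0 < x -> exists b a, x = a + omega_exp b.
Proof.
move=> x0.
have [|y [y0 [a xa]] ymin] := @least_ord (fun y => 0 < y /\ exists a, x = a + y).
  by exists x; split=> //; exists 0; rewrite add0o.
(* By minimality, the last summand [y] absorbs everything below it. *)
have absorb r : r < y -> r + y = y.
  move=> ry; have [s ys] := exists_oadd (ltW ry); rewrite {2}ys; congr (_ + _).
  apply: le_anti; rewrite {2}ys leo_addl andbT; apply: ymin; split.
    rewrite lt0o_neq; apply/eqP => s0.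
    by move: ry; rewrite ys s0 addo0 ltxx.
  by exists (a + r); rewrite xa ys addoA.
have [|c yc cmin] := @least_ord (fun c => y <= omega_exp c).
  by exists y; apply: leo_expl.
exists c, a; rewrite xa; congr (_ + _); apply: le_anti; rewrite yc /= leNgt.
apply/negP => /lt_omega_exp[y00|[d dc [n yn]]]; first by rewrite y00 ltxx in y0.
have dy : omega_exp d < y.
  by rewrite ltNge; apply/negP => /cmin; rewrite leNgt dc.
have absn m : omega_exp d * onat m + y = y.
  elim: m => [|m IH]; first by rewrite mulo0 add0o.
  by rewrite onatS muloDr mulo1 -addoA absorb.
have : omega_exp d * onat n + y <= omega_exp d * onat n + 0 by rewrite absn addo0.
by rewrite leoD2l leNgt y0.
Qed.

Lemma olog_last_term x : 0 < x -> exists a, x = a + omega_exp (olog x).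
Proof.
move=> x0; have [b xb] := exists_last_term x0.
exact: (@xgetPex _ 0 [set b | exists a, x = a + omega_exp b]%classic (ex_intro _ b xb)).
Qed.

Lemma olog0 : olog 0 = 0.
Proof.
rewrite /olog; apply: xgetPN => b [a] /esym E.
by have := leo_addl a (omega_exp b); rewrite E leNgt omega_exp_gt0.
Qed.

Lemma multiple_of_le_olog b x : b <= olog x -> exists k, x = omega_exp b * k.
Proof.
have [->|x0] := ord_eq0_or_gt0 x; first by exists 0; rewrite mulo0.
have [a xa] := olog_last_term x0 => /exists_oadd[d bd].
have [q [r [aq rc]]] := odivision a (omega_exp_gt0 (olog x)).
exists (omega_exp d * (q + 1)); rewrite muloA -omega_expD -bd.
by rewrite muloDr mulo1 {1}xa aq -addoA omega_exp_absorb.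
Qed.

Lemma le_olog_multiple b k x : 0 < x -> x = omega_exp b * k -> b <= olog x.
Proof.
move=> x0 xb; have [a xa] := olog_last_term x0.
rewrite leNgt; apply/negP => /lto_exp cb.
have ax : a < omega_exp b * k.
  by rewrite -xb xa -{1}[a]addo0; apply: ltoD2l; apply: omega_exp_gt0.
by have := multiple_gap_lt ax cb; rewrite -xa -xb ltxx.
Qed.

Lemma le_olog_add a b : b <= olog (a + omega_exp b).
Proof.
have [q [r [aq rc]]] := odivision a (omega_exp_gt0 b).
apply: (@le_olog_multiple _ (q + 1)).
  exact: lt_le_trans (omega_exp_gt0 b) (leo_addl _ _).
by rewrite aq muloDr mulo1 -addoA omega_exp_absorb.
Qed.

Lemma gt0_of_le_olog b x : b <= olog x -> 0 < b -> 0 < x.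
Proof.
rewrite lt0o_neq => bx b0; rewrite lt0o_neq; apply: contraNneq b0 => x0.
by rewrite x0 olog0 in bx; rewrite (leo0_eq bx).
Qed.

Lemma omega_exp_le_of_olog b x : b <= olog x -> 0 < x -> omega_exp b <= x.
Proof.
move=> /multiple_of_le_olog[k ->] x0; apply: leo_mulr.
by rewrite lt0o_neq; apply: contraTneq x0 => ->; rewrite mulo0 ltxx.
Qed.

(** * The iterated exponential *)

Lemma left_sub_add a c : left_sub a (a + c) = c.
Proof.
rewrite /left_sub; apply: xget_unique => //= d h; exact: (addoI h).
Qed.

Lemma e0 : e 0 = 0.
Proof. by rewrite /e omega_exp0 -{2}[1]addo0 left_sub_add. Qed.

Lemma e_gt0 a : 0 < a -> e a = omega_exp a.
Proof.
move=> a0; have h : 1 < omega_exp a by rewrite -omega_exp0; apply: lto_exp.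
by rewrite /e -{1}(omega_exp_absorb h) left_sub_add.
Qed.

Lemma hyperexp_gt0 n a : 0 < a -> 0 < hyperexp n a.
Proof.
move=> a0; elim: n => [//|n IH]; rewrite /hyperexp iterS e_gt0 //.
exact: omega_exp_gt0.
Qed.

Lemma hyperexpS n a : 0 < a -> hyperexp n.+1 a = omega_exp (hyperexp n a).
Proof. by move=> a0; rewrite {1}/hyperexp iterS e_gt0 ?hyperexp_gt0. Qed.

Lemma hyperexp0 n : hyperexp n 0 = 0.
Proof. by elim: n => [//|n IH]; rewrite /hyperexp iterS -/(hyperexp n 0) IH e0. Qed.

(** * The accessibility relations *)

(** The coherence condition on the sequences of the model, without the bound
    on the terms. *)
Definition coherent (x : nat -> ord) : Prop := forall i, x i.+1 <= olog (x i).

Lemma seqI_coherent L x : seqI L x -> coherent x.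
Proof. by move=> Ix i; case: (Ix i). Qed.

Lemma seqI_le L x y :
  seqI L x -> coherent y -> (forall i, y i <= x i) -> seqI L y.
Proof.
move=> Ix cy yx i; split; last exact: cy.
by apply: le_lt_trans (yx i) _; case: (Ix i).
Qed.

(** Closed form of [Rpow L n a] for positive [a]. *)
Definition jump (n : nat) (a : ord) (x y : nat -> ord) : Prop :=
  [/\ forall i, (i < n)%N -> y i < x i,
      y n + omega_exp (y n.+1) * a <= x n &
      forall i, (n < i)%N -> y i <= x i].

Lemma jump_lt n a x y : 0 < a -> jump n a x y -> y n < x n.
Proof.
move=> a0 [_ h _]; apply: lt_le_trans h; rewrite -[ltLHS]addo0; apply: ltoD2l.
exact: mulo_gt0 (omega_exp_gt0 _) a0.
Qed.

Lemma jump_Rstep n a x y : 0 < a -> jump n a x y -> Rstep n x y.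
Proof.
move=> a0 xy; have [lo _ hi] := xy; split=> // m.
rewrite leq_eqVlt => /predU1P[->|]; [exact: jump_lt xy|exact: lo].
Qed.

Lemma jump_le n a x y : 0 < a -> jump n a x y -> forall i, y i <= x i.
Proof.
move=> a0 /(jump_Rstep a0)[lo hi] i.
by case: (leqP i n) => [/lo/ltW|/hi].
Qed.

Lemma jump_mono n a b x y x' y' :
  (forall i, x i <= x' i) -> (forall i, y' i <= y i) -> b <= a ->
  jump n a x y -> jump n b x' y'.
Proof.
move=> xx yy ba [lo mid hi]; split.
- by move=> i /lo h; apply: le_lt_trans (yy i) (lt_le_trans h (xx i)).
- apply: le_trans (xx n); apply: le_trans mid; apply: leo_add => //.
  by apply: leo_mul => //; apply: leo_exp.
- by move=> i /hi h; apply: le_trans (yy i) (le_trans h (xx i)).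
Qed.

(** The value at [n] of a sequence can be raised to [v] below a coherent [x];
    the lower terms [y i] are then increased by the power of omega that
    coherence demands, and there is room for it since [x i] is a multiple of
    a larger power. *)
Lemma raise_below x y n v : coherent x ->
  (forall i, (n < i)%N -> y i.+1 <= olog (y i)) -> y n.+1 <= olog v ->
  v < x n -> (forall i, (i < n)%N -> y i < x i) ->
  exists z, [/\ coherent z, z n = v, forall i, (n < i)%N -> z i = y i &
    forall i, (i < n)%N -> y i < z i < x i].
Proof.
move=> cx; elim: n y v => [|n IH] y v cy yv vx yx.
  exists (fun i => if i is 0%N then v else y i); split=> //; last by case.
  by case=> // i; apply: cy.
pose y' i := if i == n.+1 then v else y i.
have y'E i : i != n.+1 -> y' i = y i by rewrite /y' => /negbTE->.
have y'n : y' n.+1 = v by rewrite /y' eqxx.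
have [k xk] := multiple_of_le_olog (cx n).
have room : y n + omega_exp v < x n.
  by rewrite xk; apply: multiple_gap_lt; [rewrite -xk yx|apply: lto_exp].
have [|||z [cz zn zhi zlo]] := IH y' (y n + omega_exp v) _ _ room.
- move=> i ni; rewrite (y'E i.+1) 1?gtn_eqF //.
  have [->|ne] := eqVneq i n.+1; first by rewrite y'n.
  by rewrite y'E //; apply: cy; rewrite ltn_neqAle eq_sym ne.
- by rewrite y'n le_olog_add.
- by move=> i iln; rewrite y'E ?ltn_eqF ?ltnS 1?ltnW //; apply: yx; rewrite ltnS ltnW.
exists z; split=> // [|i ni|i].
- by rewrite zhi // y'n.
- by rewrite zhi 1?ltnW // y'E // gtn_eqF.
rewrite ltnS leq_eqVlt => /predU1P[->|iln].
  rewrite zn room andbT -[ltLHS]addo0; apply: ltoD2l; exact: omega_exp_gt0.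
have := zlo _ iln; rewrite y'E // ltn_eqF //; exact: ltnW.
Qed.

(** A jump by [b + c] factors through the point reached after [b]. *)
Lemma jump_split L n b c x y : seqI L x -> seqI L y -> 0 < b -> 0 < c ->
  jump n (b + c) x y ->
  exists z, [/\ seqI L z, jump n c x z & jump n b z y].
Proof.
move=> Ix Iy b0 c0 [lo mid hi].
have cx := seqI_coherent Ix; have cy := seqI_coherent Iy.
set v := y n + omega_exp (y n.+1) * b.
have vc : v + omega_exp (y n.+1) * c <= x n by rewrite -addoA -muloDr.
have vx : v < x n.
  apply: lt_le_trans vc; rewrite -[ltLHS]addo0; apply: ltoD2l.
  exact: mulo_gt0 (omega_exp_gt0 _) c0.
have yv : y n.+1 <= olog v.
  have [k yk] := multiple_of_le_olog (cy n).
  apply: (@le_olog_multiple _ (k + b)); last by rewrite muloDr -yk.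
  by apply: lt_le_trans (leo_addl _ _); apply: mulo_gt0 => //; apply: omega_exp_gt0.
have [z [cz zn zhi zlo]] := raise_below cx (fun i _ => cy i) yv vx lo.
have xz : jump n c x z.
  split=> [i /zlo/andP[]//||i ni]; last by rewrite zhi // hi.
  by rewrite zn zhi.
exists z; split=> //; first exact: seqI_le Ix cz (jump_le c0 xz).
split=> [i /zlo/andP[]//||i ni]; last by rewrite zhi.
by rewrite zn.
Qed.

(** Since [x n] is a multiple of [omega^(y n.+1)], exceeding
    [y n + omega^(y n.+1) * b] for all [b < a] amounts to reaching
    [y n + omega^(y n.+1) * a], also when [a] is a successor. *)
Lemma jump_of_steps n a x y : coherent x -> 0 < a ->
  (forall i, (i < n)%N -> y i < x i) -> (forall i, (n < i)%N -> y i <= x i) ->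
  (forall b, b < a -> y n + omega_exp (y n.+1) * b < x n) -> jump n a x y.
Proof.
move=> cx a0 lo hi steps; split=> //.
have [k xk] := multiple_of_le_olog (le_trans (hi n.+1 (ltnSn n)) (cx n)).
rewrite leNgt; apply/negP => /lt_oadd[xy|[u /lt_omul[b [r [ba rp ub]]] xu]].
  have := steps _ a0; rewrite mulo0 addo0 => yx.
  by have := lt_trans xy yx; rewrite ltxx.
have /multiple_gap_lt/(_ rp) : y n + omega_exp (y n.+1) * b < omega_exp (y n.+1) * k.
  by rewrite -xk; apply: steps.
rewrite -xk ltNge => /negP; apply; apply: le_trans xu _.
by rewrite -addoA leoD2l.
Qed.

Lemma Rpow0P L n x y : Rpow L n 0 x y <-> x = y.
Proof.
split=> [|->]; last exact: Rpow0.
move E : 0 => c R; case: R E => // a {}x {}y _ E.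
by have := leo_addr 1 a; rewrite -E leNgt lt01o.
Qed.

Lemma Rpow_gt0P L n a x y : 0 < a ->
  Rpow L n a x y <->
  forall b, b < a -> exists z, [/\ seqI L z, Rstep n x z & Rpow L n b z y].
Proof.
move=> a0; split=> [R|]; first by case: R a0 => // {}x; rewrite ltxx.
by move: a0; rewrite -le1o => /exists_oadd[c ->]; apply: RpowS.
Qed.

Lemma Rpow_jump L n a x y : seqI L x -> seqI L y -> 0 < a ->
  Rpow L n a x y <-> jump n a x y.
Proof.
elim/ord_ind: a x y => a IH x y Ix Iy a0; rewrite Rpow_gt0P //; split.
  move=> steps.
  have step b : b < a -> exists z, [/\ Rstep n x z, forall i, y i <= z i &
      y n + omega_exp (y n.+1) * b <= z n].
    move=> ba; have [z [Iz xz zy]] := steps b ba; exists z; split=> //.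
      have [b0|b0] := ord_eq0_or_gt0 b; first by move: zy; rewrite b0 => /Rpow0P->.
      exact: jump_le b0 ((IH _ ba _ _ Iz Iy b0).1 zy).
    have [b0|b0] := ord_eq0_or_gt0 b.
      by move: zy; rewrite b0 mulo0 addo0 => /Rpow0P->.
    by have /(IH _ ba _ _ Iz Iy b0)[] := zy.
  (* The step to exponent [0] already gives the two families of inequalities. *)
  have [z0 [[xz0 xz0'] z0y _]] := step _ a0.
  apply: jump_of_steps => //; first exact: seqI_coherent Ix.
  - by move=> i ni; apply: le_lt_trans (z0y i) (xz0 _ (ltnW ni)).
  - by move=> i ni; apply: le_trans (z0y i) (xz0' _ ni).
  - move=> b /step[z [[xz _] _ h]]; exact: le_lt_trans h (xz _ (leqnn n)).
move=> xy b ba; have [b0|b0] := ord_eq0_or_gt0 b.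
  exists y; split=> //; first exact: jump_Rstep xy.
  by rewrite b0; apply: Rpow0.
have [c ac] := exists_oadd (ltW ba).
have c0 : 0 < c.
  by rewrite lt0o_neq; apply: contraTneq ba => c0; rewrite ac c0 addo0 ltxx.
move: xy; rewrite ac => /(jump_split Ix Iy b0 c0)[z [Iz xz zy]].
exists z; split=> //; first exact: jump_Rstep xz.
exact/(IH _ ba).
Qed.

(** * Truth in the model *)

Lemma forces_diaP L n (a : below L) phi x : seqI L x ->
  forces x (dia n a phi) <-> exists y, [/\ seqI L y, Rpow L n a x y & forces y phi].
Proof.
move=> Ix; rewrite /dia; case: insubP => [b _ <- //|].
rewrite (_ : (a : ord) < L) ?andbT; last exact: svalP a.
have [a0|->//] := ord_eq0_or_gt0 a; rewrite a0 ltxx => _.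
by split=> [h|[y [Iy /Rpow0P-> //]]]; exists x; split=> //; apply: Rpow0.
Qed.

Lemma forces_dia0 L n (a : below L) phi x : seqI L x -> (a : ord) = 0 ->
  forces x (dia n a phi) <-> forces x phi.
Proof.
move=> Ix a0; rewrite forces_diaP // a0.
by split=> [[y [_ /Rpow0P-> //]]|h]; exists x; split=> //; apply: Rpow0.
Qed.

Lemma forces_dia_gt0 L n (a : below L) phi x : seqI L x -> 0 < (a : ord) ->
  forces x (dia n a phi) <-> exists y, [/\ seqI L y, jump n a x y & forces y phi].
Proof.
move=> Ix a0; rewrite forces_diaP //.
by split=> -[y [Iy h yf]]; exists y; split=> //; apply/(Rpow_jump n Ix Iy a0).
Qed.

Lemma pbelow_gt0 L (a : pbelow L) : 0 < (a : ord).
Proof. by case/andP: (svalP a). Qed.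

Lemma forces_DiaP L n (a : pbelow L) phi x : seqI L x ->
  forces x (Dia n a phi) <-> exists y, [/\ seqI L y, jump n a x y & forces y phi].
Proof.
move=> Ix /=; split=> -[y [Iy h yf]]; exists y; split=> //.
  exact/(Rpow_jump n Ix Iy (pbelow_gt0 a)).
exact/(Rpow_jump n Ix Iy (pbelow_gt0 a)).
Qed.

Lemma forces_persistent L (phi : form L) x x' :
  seqI L x -> seqI L x' -> (forall i, x i <= x' i) -> forces x phi -> forces x' phi.
Proof.
move=> Ix Ix' xx; elim: phi => [//|phi IHp psi IHq /= [/IHp ? /IHq ?] //|n a phi _].
rewrite !forces_DiaP // => -[y [Iy xy yphi]]; exists y; split=> //.
exact: jump_mono xy.
Qed.

(** The least sequence is the pointwise minimum of all those above [c]; it is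
    coherent because each of its terms is attained by one of them. *)
Lemma least_seqI_above L (c x0 : nat -> ord) :
  seqI L x0 -> (forall i, c i <= x0 i) ->
  exists v, [/\ seqI L v, forall i, c i <= v i &
    forall x, seqI L x -> (forall i, c i <= x i) -> forall i, v i <= x i].
Proof.
move=> Ix0 cx0.
have /choice[w wP] : forall i, exists x, [/\ seqI L x, forall j, c j <= x j &
    forall x', seqI L x' -> (forall j, c j <= x' j) -> x i <= x' i].
  move=> i; have [|_ [x Ix [cx <-]] xmin] := @least_ord (fun v =>
    exists2 x, seqI L x & (forall j, c j <= x j) /\ x i = v); first by exists (x0 i), x0.
  by exists x; split=> // x' Ix' cx'; apply: xmin; exists x'.
exists (fun i => w i i); split=> [i|i|x Ix cx i].
- have [Iw cw _] := wP i; split; first by case: (Iw i).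
  have [_ _ wmin] := wP i.+1.
  by apply: le_trans (wmin _ Iw cw) _; case: (Iw i).
- by have [_ cw _] := wP i.
- by have [_ _ wmin] := wP i; apply: wmin.
Qed.

(** A satisfiable formula expresses a lower bound on each term of the
    sequence. *)
Lemma forces_bounds L (phi : form L) x0 : seqI L x0 -> forces x0 phi ->
  exists c, forall x, seqI L x -> forces x phi <-> forall i, c i <= x i.
Proof.
elim: phi x0 => [|phi IHp psi IHq|n a phi IH] x0 Ix0.
- by move=> _; exists (fun=> 0) => x Ix; split=> // _ i; apply: le0o.
- move=> /= [/(IHp _ Ix0)[c cP] /(IHq _ Ix0)[d dP]].
  exists (fun i => Order.max (c i) (d i)) => x Ix; rewrite cP // dP //.
  split=> [[cx dx] i|h]; first by rewrite ge_max cx dx.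
  by split=> i; have := h i; rewrite ge_max => /andP[].
rewrite forces_DiaP // => -[y0 [Iy0 _ y0phi]].
have [d dP] := IH _ Iy0 y0phi.
have [v [Iv dv vmin]] := least_seqI_above Iy0 ((dP _ Iy0).1 y0phi).
exists (fun i => if (i < n)%N then v i + 1 else
                 if i == n then v n + omega_exp (v n.+1) * a else v i) => x Ix.
rewrite forces_DiaP //; split=> [[y [Iy xy yphi]]|h].
  have [lo mid hi] : jump n a x v.
    by apply: jump_mono xy => //; apply: vmin => //; apply/dP.
  move=> i; case: ltnP => [/lo|]; first by rewrite leo_add1.
  rewrite leq_eqVlt eq_sym => /predU1P[->|ni]; first by rewrite eqxx.
  by rewrite gtn_eqF // hi.
exists v; split=> //; last exact/dP.
split=> [i ni||i ni].
- by have := h i; rewrite ni leo_add1.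
- by have := h n; rewrite ltnn eqxx.
- by have := h i; rewrite ltnNge (ltnW ni) gtn_eqF.
Qed.

Lemma least_model L (phi : form L) x0 : seqI L x0 -> forces x0 phi ->
  exists v, [/\ seqI L v, forces v phi &
    forall x, seqI L x -> forces x phi -> forall i, v i <= x i].
Proof.
move=> Ix0 x0phi; have [c cP] := forces_bounds Ix0 x0phi.
have [v [Iv cv vmin]] := least_seqI_above Ix0 ((cP _ Ix0).1 x0phi).
exists v; split=> //; first exact/cP.
by move=> x Ix /(cP _ Ix); apply: vmin.
Qed.

(** * Soundness of the axioms and rules *)

Lemma sound_mono L n (a b : below L) (phi : form L) :
  (b : ord) < (a : ord) -> models (dia n a phi) (dia n b phi).
Proof.
move=> ba x Ix; have a0 : 0 < (a : ord) by apply: le_lt_trans ba; apply: le0o.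
rewrite forces_dia_gt0 // => -[y [Iy xy yphi]].
have [b0|b0] := ord_eq0_or_gt0 b.
  by rewrite forces_dia0 //; apply: forces_persistent yphi => //; apply: jump_le xy.
rewrite forces_dia_gt0 //; exists y; split=> //.
by apply: jump_mono xy => //; apply: ltW.
Qed.

Lemma sound_coadd L n (a b c : below L) (phi : form L) x :
  (c : ord) = b + a -> seqI L x ->
  forces x (dia n c phi) <-> forces x (dia n a (dia n b phi)).
Proof.
move=> cE Ix.
have [a0|a0] := ord_eq0_or_gt0 a.
  rewrite (forces_dia0 n (dia n b phi)) //.
  by rewrite !forces_diaP // cE a0 addo0.
rewrite (forces_dia_gt0 n (dia n b phi)) //.
have [b0|b0] := ord_eq0_or_gt0 b.
  have ca : (c : ord) = a by rewrite cE b0 add0o.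
  rewrite forces_dia_gt0 ?ca //.
  by split=> -[y [Iy xy]] h; exists y; split=> //; apply/(forces_dia0 n phi Iy b0).
have c0 : 0 < (c : ord) by rewrite cE; apply: lt_le_trans b0 (leo_addr _ _).
rewrite forces_dia_gt0 // cE; split.
  move=> [y [Iy /(jump_split Ix Iy b0 a0)[z [Iz xz zy]] yphi]].
  by exists z; split=> //; rewrite forces_dia_gt0 //; exists y.
move=> [z [Iz xz]]; rewrite forces_dia_gt0 // => -[y [Iy zy yphi]].
have [_ xzn _] := xz; have [ylo zyn yhi] := zy.
have zx := jump_le a0 xz.
exists y; split=> //; split=> [i ni||i ni].
- by apply: lt_le_trans (ylo _ ni) (zx i).
- rewrite muloDr addoA; apply: le_trans xzn; apply: leo_add => //.
  by apply: leo_mul => //; apply: leo_exp; apply: yhi.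
- exact: le_trans (yhi _ ni) (zx i).
Qed.

Lemma jump_reduce n a x y : coherent x -> 0 < a ->
  jump n.+1 a x y -> jump n (omega_exp a) x y.
Proof.
move=> cx a0 xy; have le_yx := jump_le a0 xy; have [lo mid hi] := xy.
split=> [i ni||i _]; [by apply: lo; apply: ltnW| |exact: le_yx].
rewrite -omega_expD.
have h : y n.+1 + a <= olog (x n).
  apply: le_trans (cx n); apply: le_trans mid; rewrite leoD2l.
  by apply: leo_mull; apply: omega_exp_gt0.
have [k xk] := multiple_of_le_olog h.
by rewrite [leRHS]xk; apply: multiple_gap; rewrite -xk; apply: lo.
Qed.

Lemma jump_hyperexp n m a x y : coherent x -> 0 < a ->
  jump (n + m)%N a x y -> jump n (hyperexp m a) x y.
Proof.
move=> cx a0; elim: m n => [|m IH] n; first by rewrite addn0.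
rewrite -addSnnS => /IH; rewrite hyperexpS //.
by apply: jump_reduce => //; apply: hyperexp_gt0.
Qed.

Lemma sound_reduction L n m (a c : below L) (phi : form L) :
  (c : ord) = hyperexp m a -> models (dia (n + m)%N a phi) (dia n c phi).
Proof.
move=> cE x Ix; have [a0|a0] := ord_eq0_or_gt0 a.
  by rewrite !forces_dia0 // cE a0 hyperexp0.
rewrite (forces_dia_gt0 (n + m)%N) // => -[y [Iy xy yphi]].
rewrite forces_dia_gt0 ?cE ?hyperexp_gt0 //; exists y; split=> //.
exact: jump_hyperexp (seqI_coherent Ix) a0 xy.
Qed.

(** Given [x R_n^a y] with [y] forcing [phi], hence [psi], the term [y m] is
    raised so that the new point still lies below [x] and sees, along
    [R_m^(b+1)], the least model [v] of [psi]. Since [b + 1] is a successor,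
    it is enough to pass [v m + omega^(v m.+1) * b] and to add
    [omega^(y m.+1)], and this stays below [x m], a multiple of the larger
    power [omega^(x m.+1)]. *)
Lemma sound_R4 L n m (a b c : below L) (phi psi : form L) :
  models phi psi -> (m < n)%N -> (c : ord) = b + 1 ->
  models (And (dia n a phi) (dia m c psi)) (dia n a (And phi (dia m c psi))).
Proof.
move=> phipsi mn cE x Ix [].
have [a0|a0] := ord_eq0_or_gt0 a.
  by move=> /(forces_dia0 n phi Ix a0) xphi xpsi; apply/(forces_dia0 n _ Ix a0).
have c0 : 0 < (c : ord) by rewrite cE; apply: lt_le_trans lt01o (leo_addl _ _).
move=> /(forces_dia_gt0 n phi Ix a0)[y [Iy xy yphi]].
have ypsi := phipsi _ Iy yphi.
move=> /(forces_dia_gt0 m psi Ix c0)[w [Iw xw wpsi]].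
have [v [Iv vpsi vmin]] := least_model Iw wpsi.
have vy := vmin _ Iy ypsi; have vw := vmin _ Iw wpsi.
have yx := jump_le a0 xy; have [ylo ymid yhi] := xy.
have [_ xv _] : jump m c x v by apply: jump_mono xw.
set r := v m + omega_exp (v m.+1) * b.
have rx : r < x m.
  apply: lt_le_trans xv; rewrite cE muloDr mulo1 addoA -/r -{1}[r]addo0.
  by apply: ltoD2l; apply: omega_exp_gt0.
set u := Order.max (y m) r + omega_exp (y m.+1).
have ymx : y m.+1 < x m.+1.
  move: mn; rewrite leq_eqVlt => /predU1P[E|/ylo//].
  by rewrite E; apply: jump_lt xy.
have ux : u < x m.
  have [k xk] := multiple_of_le_olog (seqI_coherent Ix m).
  rewrite xk; apply: multiple_gap_lt; last exact: lto_exp.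
  by rewrite -xk gt_max rx ylo.
have [z [cz zm zhi zlo]] := raise_below (seqI_coherent Ix)
  (fun i _ => seqI_coherent Iy i) (le_olog_add _ _) ux (fun i im => ylo _ (ltn_trans im mn)).
have zx i : z i <= x i.
  by case: (ltngtP i m) => [/zlo/andP[_ /ltW]|/zhi->|->] //; rewrite zm ltW.
have yu : y m <= u by apply: le_trans (leo_addr _ _); rewrite le_max lexx.
have yz i : y i <= z i.
  by case: (ltngtP i m) => [/zlo/andP[/ltW]|/zhi->|->] //; rewrite zm.
have Iz : seqI L z := seqI_le Ix cz zx.
apply/(forces_dia_gt0 n _ Ix a0); exists z; split=> //.
  split=> [i ni||i ni].
  - case: (ltngtP i m) => [/zlo/andP[]//|/zhi->|->]; [exact: ylo|by rewrite zm].
  - by rewrite !zhi // (leq_trans mn).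
  - by rewrite zhi ?yhi // (ltn_trans mn).
split; first exact: forces_persistent yphi.
apply/(forces_dia_gt0 m _ Iz c0); exists v; split=> //; split=> [i im||i _].
- by apply: le_lt_trans (vy i) _; case/andP: (zlo _ im).
- rewrite zm cE muloDr mulo1 addoA; apply: leo_add; last exact: leo_exp.
  by rewrite -/r le_max lexx orbT.
- exact: le_trans (vy i) (yz i).
Qed.

(** * Monomial normal forms and the Schmerl axiom *)

Lemma hyperexp_le_coherent x i k a : coherent x -> 0 < a -> a <= x (i + k)%N ->
  hyperexp k a <= x i.
Proof.
move=> cx a0; elim: k i => [|k IH] i; first by rewrite addn0.
rewrite -addSnnS => /IH h; rewrite hyperexpS //; apply: le_trans (leo_exp h) _.
apply: omega_exp_le_of_olog; first exact: cx.
apply: gt0_of_le_olog (cx i) _; exact: lt_le_trans (hyperexp_gt0 k a0) h.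
Qed.

(** The sequence with value [a] at [n], the values of [y] above [n], and
    below [n] the least values that coherence allows when [a] is positive. *)
Definition tower (n : nat) (a : ord) (y : nat -> ord) (i : nat) : ord :=
  if (i <= n)%N then hyperexp (n - i) a else y i.

Lemma tower_coherent n a y : 0 < a -> y n.+1 <= olog a ->
  (forall i, (n < i)%N -> y i.+1 <= olog (y i)) -> coherent (tower n a y).
Proof.
move=> a0 yn cy i; rewrite /tower; case: (ltngtP i n) => [lt|gt|->].
- by rewrite -(subnSK lt) hyperexpS // -[in leRHS](add0o (omega_exp _)) le_olog_add.
- exact: cy.
- by rewrite subnn.
Qed.

Lemma tower_le n a y x : coherent x -> 0 < a ->
  (forall i, tower n a y i <= x i) <->
  a <= x n /\ (forall i, (n < i)%N -> y i <= x i).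
Proof.
move=> cx a0; split=> [h|[an yx] i].
  split=> [|i ni]; first by have := h n; rewrite /tower leqnn subnn.
  by have := h i; rewrite /tower leqNgt ni.
rewrite /tower; case: leqP => [ilen|]; last exact: yx.
by apply: hyperexp_le_coherent; rewrite ?subnKC.
Qed.

Lemma coherent0 : coherent (fun=> 0). Proof. by move=> i; apply: le0o. Qed.

Lemma jump_origin n a x : coherent x -> 0 < a -> a <= x n -> jump n a x (fun=> 0).
Proof.
move=> cx a0 an; split=> [i ni||i _]; [|by rewrite omega_exp0 mul1o add0o|exact: le0o].
apply: lt_le_trans (hyperexp_gt0 (n - i) a0) _.
by apply: hyperexp_le_coherent; rewrite ?subnKC // ltnW.
Qed.

Lemma forces_dia_top L n (a : below L) x : seqI L x ->
  forces x (dia n a Top) <-> (a : ord) <= x n.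
Proof.
move=> Ix; have cx := seqI_coherent Ix.
have [a0|a0] := ord_eq0_or_gt0 a; first by rewrite forces_dia0 // a0 le0o.
rewrite forces_dia_gt0 //; split=> [[y [_ [_ mid _] _]]|an].
  apply: le_trans mid; apply: le_trans (leo_addl _ _).
  by apply: leo_mull; apply: omega_exp_gt0.
exists (fun=> 0); split=> //; last exact: jump_origin.
by apply: seqI_le Ix coherent0 _ => i; apply: le0o.
Qed.

Lemma forces_Dia_Top L n (a : pbelow L) x : seqI L x ->
  forces x (Dia n a Top) <-> (a : ord) <= x n.
Proof.
move=> Ix; have cx := seqI_coherent Ix; have a0 := pbelow_gt0 a.
rewrite forces_DiaP //; split=> [[y [_ [_ mid _] _]]|an].
  apply: le_trans mid; apply: le_trans (leo_addl _ _).
  by apply: leo_mull; apply: omega_exp_gt0.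
exists (fun=> 0); split=> //; last exact: jump_origin.
by apply: seqI_le Ix coherent0 _ => i; apply: le0o.
Qed.

(** The least model of a monomial normal form headed by [<n^a> Top] is the
    tower of exponentials [e^(n - i)(a)] up to [n]. The form [e^(n0-n)(a0)*(2+d)]
    of the exponents makes these least models coherent. *)
Lemma MNF_least_model L (phi : form L) : MNF phi ->
  exists y, [/\ coherent y,
    forall x, seqI L x -> forces x phi <-> forall i, y i <= x i &
    forall n a, headed n a phi ->
      forall i, (i <= n)%N -> y i = hyperexp (n - i) a].
Proof.
elim=> {phi} [|n a|n a n0 a0 d phi _ [y [cy yP yhead]] hphi nn0 aE].
- exists (fun=> 0); split=> //; first exact: coherent0.
    by move=> x Ix; split=> // _ i; apply: le0o.
  by move=> n a [|[psi]].
- exists (tower n a (fun=> 0)); split.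
  + by apply: tower_coherent => //; [exact: pbelow_gt0|exact: le0o|move=> *; exact: le0o].
  + move=> x Ix; rewrite forces_Dia_Top // (tower_le _ _ (seqI_coherent Ix)) ?pbelow_gt0 //.
    by split=> [an|[]//]; split=> // i _; apply: le0o.
  + move=> m b [[<- <-]|[psi]] // i im; by rewrite /tower im.
have apos := pbelow_gt0 a; have a0pos := pbelow_gt0 a0.
have yn1 : y n.+1 = hyperexp (n0 - n.+1) a0 by apply: yhead.
have yn : y n = omega_exp (y n.+1).
  by rewrite yn1 -hyperexpS // subnSK //; apply: yhead => //; apply: ltnW.
have aE' : (a : ord) = omega_exp (y n.+1) * (2 + d).
  by rewrite aE -yn; congr (_ * _); rewrite (yhead _ _ hphi) // ltnW.
exists (tower n a y); split.
- apply: tower_coherent => //; exact: le_olog_multiple apos aE'.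
- move=> x Ix; have cx := seqI_coherent Ix.
  rewrite (tower_le _ _ cx apos).
  rewrite -[X in X <-> _]/(forces x (Dia n a Top) /\ forces x phi).
  rewrite forces_Dia_Top // yP //; split=> -[an yx]; split=> // i.
  case: (leqP i n) => [ilen|]; last exact: yx.
  rewrite (yhead _ _ hphi) ?(leq_trans ilen (ltnW nn0)) //.
  apply: hyperexp_le_coherent => //; rewrite subnKC ?(leq_trans ilen (ltnW nn0)) //.
  by have := yx _ nn0; rewrite (yhead _ _ hphi) // subnn.
- by move=> m b [//|[chi [<- <- _]]] i im; rewrite /tower im.
Qed.

Lemma sound_schmerl L n (a c : below L) n0 (a0 : pbelow L) (phi : form L) x :
  MNF phi -> headed n0 a0 phi -> (n < n0)%N ->
  (c : ord) = hyperexp (n0 - n) a0 * (1 + a) -> seqI L x ->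
  forces x (dia n a phi) <-> forces x (And (dia n c Top) phi).
Proof.
move=> Mphi hphi nn0 cE Ix; have cx := seqI_coherent Ix.
have [v [cv vP vhead]] := MNF_least_model Mphi.
have vhyp i : (i <= n)%N -> v i = omega_exp (v i.+1).
  move=> ilen; have ilt := leq_ltn_trans ilen nn0.
  rewrite (vhead _ _ hphi i (ltnW ilt)) (vhead _ _ hphi i.+1 ilt).
  by rewrite -hyperexpS ?pbelow_gt0 // subnSK.
have cE' : (c : ord) = v n + omega_exp (v n.+1) * a.
  by rewrite cE -(vhead _ _ hphi n (ltnW nn0)) muloDr mulo1 -vhyp.
rewrite -[X in _ <-> X]/(forces x (dia n c Top) /\ forces x phi).
rewrite forces_dia_top // vP //.
have [az|a0'] := ord_eq0_or_gt0 a.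
  rewrite forces_dia0 // vP // cE' az mulo0 addo0.
  by split=> [vx|[]].
rewrite forces_dia_gt0 //; split=> [[y [Iy xy /(vP _ Iy) vy]]|[cxn vx]].
  split=> [|i]; last exact: le_trans (vy i) (jump_le a0' xy i).
  by rewrite cE'; have [_ ? _] : jump n a x v by apply: jump_mono xy.
have Iv : seqI L v := seqI_le Ix cv vx.
exists v; split=> //; last exact/vP.
rewrite cE' in cxn.
have vxn : v n < x n.
  apply: lt_le_trans cxn; rewrite -[ltLHS]addo0; apply: ltoD2l.
  exact: mulo_gt0 (omega_exp_gt0 _) a0'.
have below_n k : (k <= n)%N -> v (n - k)%N < x (n - k)%N.
  elim: k => [|k IH] kn; first by rewrite subn0.
  have E : (n - k = (n - k.+1).+1)%N by rewrite subnSK.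
  move: (IH (ltnW kn)); rewrite E (vhyp (n - k.+1)%N) ?leq_subr // => /lto_exp h.
  apply: lt_le_trans h (omega_exp_le_of_olog (cx _) _).
  apply: gt0_of_le_olog (cx _) _; rewrite -E; exact: le_lt_trans (le0o _) (IH (ltnW kn)).
split=> // i ni; rewrite -(subKn (ltnW ni)); apply: below_n; exact: leq_subr.
Qed.

Theorem theorem7p2 (L : ord) (L_recursive : recursive_ordinal L)
    (L_epsilon : epsilon_number L) (phi psi : form L) :
  derives phi psi -> models phi psi.
Proof.
elim=> {phi psi}.
- by move=> phi x.
- by move=> phi x.
- by move=> phi psi x _ [].
- by move=> phi psi x _ [].
- by move=> *; apply: sound_mono.
- by move=> n a b c phi cE x Ix /(sound_coadd n phi cE Ix).
- by move=> n a b c phi cE x Ix /(sound_coadd n phi cE Ix).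
- by move=> *; apply: sound_reduction.
- by move=> n a c n0 a0 phi M h nn0 cE x Ix /(sound_schmerl M h nn0 cE Ix).
- by move=> n a c n0 a0 phi M h nn0 cE x Ix /(sound_schmerl M h nn0 cE Ix).
- by move=> phi psi chi _ IH1 _ IH2 x Ix xphi; split; [apply: IH1|apply: IH2].
- by move=> phi psi chi _ IH1 _ IH2 x Ix /(IH1 _ Ix)/(IH2 _ Ix).
- move=> n a phi psi _ IH x Ix /(forces_diaP n a phi Ix)[y [Iy xy /(IH _ Iy) ypsi]].
  by apply/(forces_diaP n a psi Ix); exists y.
- by move=> n m a b c phi psi _ IH mn cE; apply: sound_R4 mn cE.
Qed.
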